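(* For $n=3$, no proper nonstrict pattern $I\subseteq\{1,2,3\}\times\{1,2,3\}$ of size $3$ is $3$-universal.
   Context: A pattern is a finite set of positions, i.e. of ordered pairs of positive integers. Let $L(n)$ be the space of traceless complex $n\times n$ matrices. For a pattern $I\subseteq\{1,\dots,n\}^2$, $L_I(n)$ is the subspace of all $X=[x_{ij}]\in L(n)$ with $x_{ij}=0$ for all $(i,j)\in I$. The pattern $I$ is $n$-universal if every matrix in $L(n)$ is unitarily similar (by an element of $\mathrm{U}(n)$) to a matrix in $L_I(n)$. The pattern $I$ is strict if it contains no diagonal position $(i,i)$ (nonstrict otherwise), and it is proper (for $n$) if $(i,i)\notin I$ for at least one $i\in\{1,\dots,n\}$. The size of $I$ is its cardinality. *)

(* Defs.v *)
From mathcomp Require Import all_boot all_order all_algebra.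
From mathcomp Require Import complex reals.

Set Implicit Arguments.
Unset Strict Implicit.
Unset Printing Implicit Defensive.

Import GRing.Theory Num.Theory.
Local Open Scope ring_scope.
Local Open Scope complex_scope.

(* Rows and columns are numbered from 0, so the position written (i, j) in
   1-based mathematical notation is (i - 1, j - 1) here. *)
Definition pattern (n : nat) := {set 'I_n * 'I_n}.

Definition strict_pattern (n : nat) (I : pattern n) : bool :=
  [forall i, (i, i) \notin I].

Definition proper_pattern (n : nat) (I : pattern n) : bool :=
  [exists i, (i, i) \notin I].

Definition traceless (R : realType) (n : nat) : {pred 'M[R[i]]_n} :=
  [pred X : 'M[R[i]]_n | \tr X == 0].

Definition traceless_zero_on (R : realType) (n : nat) (I : pattern n) :
    {pred 'M[R[i]]_n} :=
  [pred X : 'M[R[i]]_n |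
    (X \in @traceless R n) && [forall p in I, X p.1 p.2 == 0]].

Definition universal_pattern (R : realType) (n : nat) (I : pattern n) : Prop :=
  forall A : 'M[R[i]]_n, A \in @traceless R n ->
  exists2 X : 'M[R[i]]_n,
    X \in @traceless_zero_on R n I & A ~_{in unitarymx} X.

(* Main.v *)
(* A = diag(1, i, -1-i) is not unitarily similar to a matrix vanishing on I. The
   proof uses only that A is normal, traceless and invertible, that its eigenvalues are not collinear (A <> c A^* ) and that they
   do not form an equilateral triangle (A^3 <> c). For a matrix X with these
   properties, comparing the entries of X X^* and X^* X shows that if a row (or,
   transposing, a column) contains a zero off the diagonal besides a zero on the
   diagonal, then X has no further zero entry. This leaves only the patterns
   {(i,i), (j,k), (k,j)}, for which X would be proportional to X^*. *)
Require Import Defs.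
From mathcomp Require Import all_boot all_order all_algebra.
From mathcomp Require Import complex reals.
From mathcomp Require Import ring.

Set Implicit Arguments.
Unset Strict Implicit.
Unset Printing Implicit Defensive.

Import GRing.Theory Num.Theory.

(** * Three distinct indices in arbitrary order *)

Section ThreeIndices.
Local Open Scope ring_scope.
Variables i j k : 'I_3.
Hypothesis ijk_uniq : uniq [:: i; j; k].

Lemma ord3_enum l : l \in [:: i; j; k].
Proof.
have [] := uniq_min_size ijk_uniq (s2 := enum 'I_3).
- by move=> x _; rewrite mem_enum.
- by rewrite size_enum_ord.
by move=> _ /(_ l); rewrite mem_enum => ->.
Qed.

(** Keeping [i], [j], [k] arbitrary lets one argument cover all simultaneous relabelings of rows and
    columns; eliminating both indices of an entry gives the nine cases. *)
Lemma ord3_ind (P : 'I_3 -> Prop) : P i -> P j -> P k -> forall l, P l.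
Proof.
by move=> Pi Pj Pk l; move: (ord3_enum l); rewrite !inE => /or3P[] /eqP->.
Qed.

Lemma sum_ord3 (V : nmodType) (F : 'I_3 -> V) : \sum_l F l = F i + F j + F k.
Proof.
rewrite -addrA (perm_big [:: i; j; k]) /=; first by rewrite !big_cons big_nil addr0.
by apply: uniq_perm => // [|l]; rewrite ?index_enum_uniq // mem_index_enum ord3_enum.
Qed.

End ThreeIndices.

Lemma ord3_third (i j : 'I_3) : i != j -> exists k, uniq [:: i; j; k].
Proof.
move=> nij; have: (0 < #|~: [set i; j]|)%N.
  by rewrite cardsCs setCK cards2 nij card_ord.
by case/card_gt0P=> k; rewrite !inE negb_or => /andP[ki kj]; exists k;
  rewrite /= !inE negb_or nij eq_sym ki eq_sym kj.
Qed.

(** * Generic normal matrices and their zero entries *)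

Section GenericNormal.
Local Open Scope ring_scope.
Local Open Scope sesquilinear_scope.
Variable C : numClosedFieldType.
Implicit Types X P : 'M[C]_3.

(* For a normal, traceless, invertible X, X = c X^* says that the eigenvalues are real up to a common
   phase, and X^3 = c says that they are the three cube roots of c. *)
Definition generic_normal X : Prop :=
  [/\ X \is normalmx, \tr X = 0, \det X != 0,
      forall c, X <> c *: X^t* & forall c, X *m X *m X <> c%:M].

(** Conjugation by a unitary [P] is an injective ring morphism that commutes with the adjoint and
    fixes scalar matrices, so every clause is transported. *)
Lemma generic_normal_unitary P X :
  P \is unitarymx -> generic_normal X -> generic_normal (P *m X *m P^t*).
Proof.
move=> uP [/normalmxP nX tX dX cX sX]; pose f M : 'M[C]_3 := P *m M *m P^t*.
have fM M N : f M *m f N = f (M *m N).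
  by rewrite /f !mulmxA mulmxKtV.
have fC M : (f M)^t* = f (M^t*).
  by rewrite /f !trmx_mul !map_mxM trmxCK mulmxA.
have P1 : P^t* *m P = 1%:M by rewrite -invmx_unitary // mulVmx ?unitarymx_unit.
have f_inj : injective f.
  move=> M N /(congr1 (fun M => P^t* *m M *m P)).
  by rewrite /f !mulmxA P1 !mul1mx -!mulmxA P1 !mulmx1.
have fS c : f c%:M = c%:M.
  by rewrite /f scalar_mxC -mulmxA (unitarymxP uP) mulmx1.
rewrite -/(f X); split.
- by apply/normalmxP; rewrite fC !fM nX.
- by rewrite /f mxtrace_mulC mulmxA P1 mul1mx.
- by rewrite /f !det_mulmx mulrAC -det_mulmx (unitarymxP uP) det1 mul1r.
- move=> c e; apply: (cX c); apply: f_inj.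
  by rewrite e fC /f -scalemxAr -scalemxAl.
- move=> c e; apply: (sX c); apply: f_inj.
  by rewrite fS -e !fM.
Qed.

Lemma generic_normal_tr X : generic_normal X -> generic_normal X^T.
Proof.
move=> [/normalmxP nX tX dX cX sX]; split.
- have e : X ^ Num.conj = (X^t*)^T by rewrite map_trmx trmxK.
  by apply/normalmxP; rewrite trmxK e -!trmx_mul nX.
- by rewrite mxtrace_tr.
- by rewrite det_tr.
- move=> c /(congr1 trmx); rewrite trmxK => e; apply: (cX c).
  by rewrite {1}e linearZ /= map_trmx.
- move=> c /(congr1 trmx); rewrite !trmx_mul !trmxK tr_scalar_mx => e.
  by apply: (sX c); rewrite -e mulmxA.
Qed.

Lemma normalmx_entries X (x y : 'I_3) : X \is normalmx ->
  \sum_l X x l * (X y l)^* = \sum_l (X l x)^* * X l y.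
Proof.
move=> /normalmxP /matrixP /(_ x y); rewrite !mxE.
by under eq_bigr do rewrite !mxE; under [in RHS]eq_bigr do rewrite !mxE.
Qed.


Lemma traceless_last_diag X i j k : uniq [:: i; j; k] ->
  \tr X = 0 -> X i i = 0 -> X k k = - X j j.
Proof.
move=> ijk; rewrite /mxtrace (sum_ord3 ijk) => tX Xii.
by apply/eqP; rewrite -addr_eq0 addrC -tX Xii add0r.
Qed.

(** If [X i k] vanished, so would row [i] and the determinant; [X j i] = 0 would make [X] a multiple
    of its adjoint, and [X k i] = 0 would make its cube scalar. A zero in the block on [j], [k]
    forces [X j i] or [X k i] to vanish. *)
Lemma zero_pair_other_entries X i j k : uniq [:: i; j; k] ->
  generic_normal X -> X i i = 0 -> X i j = 0 ->
  [/\ X i k != 0, X j i != 0 & X k i != 0] /\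
  [/\ X j j != 0, X j k != 0, X k j != 0 & X k k != 0].
Proof.
move=> ijk [nX tX dX cX sX] Xii Xij.
have Xkk := traceless_last_diag ijk tX Xii.
have N x y := normalmx_entries x y nX.
have conjE := (rmorphN (@Num.conj C), rmorph0 (@Num.conj C)).
have := N j k; have := N j j; have := N i k; have := N i j; have := N i i.
rewrite !(sum_ord3 ijk) Xii Xij Xkk !conjE.
(* In the order [i], [j], [k] the rows of [X] are (0, 0, a), (b, p, q), (d, r, -p). The digits in
   [h11] to [h23] give the position at which the two products are compared. *)
move Ea : (X i k) => a; move Eb : (X j i) => b; move Ed : (X k i) => d.
move Ep : (X j j) => p; move Eq : (X j k) => q; move Er : (X k j) => r.
rewrite Ep in Xkk; rewrite !(mul0r, mulr0, add0r, addr0, mulrN, mulNr).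
move=> h11 h12 h13 h22 h23.
have {}h22 : b * b^* + q * q^* = r^* * r.
  apply/eqP; rewrite -subr_eq0; move/eqP: h22; rewrite -subr_eq0 => /eqP <-.
  by apply/eqP; ring.
have a0 : a != 0.
  apply: contraNneq dX => a0; rewrite (expand_det_row _ i) (sum_ord3 ijk).
  by rewrite Xii Xij Ea a0 !mul0r !addr0.
have b0 : b != 0.
  (* Otherwise |a| = |d| and X = (a / d^* ) X^*. *)
  apply/eqP => b0; rewrite b0 in Eb.
  rewrite b0 ?(conjE, mul0r, mulr0, add0r) in h11 h12 h13 h22.
  have d0 : d != 0.
    by apply: contraNneq a0 => d0; rewrite -mul_conjC_eq0 h11 d0 mulr0.
  have dc0 : d^* != 0 by rewrite conjC_eq0.
  have ac0 : a^* != 0 by rewrite conjC_eq0.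
  have pE : p = a / d^* * p^*.
    by apply: (mulfI dc0); rewrite -[LHS]opprK -h13; field.
  have rE : r = a / d^* * q^*.
    by apply: (mulfI dc0); rewrite -h12; field.
  have qE : q = a / d^* * r^*.
    rewrite rE rmorphM fmorph_div /= !conjCK mulrA.
    have -> : a / d^* * (a^* / d) = a * a^* / (d^* * d) by field; rewrite d0.
    by rewrite h11 divff ?mul1r // mulf_neq0.
  apply: (cX (a / d^*)); apply/matrixP => x y; rewrite !mxE.
  have dE : d = a / d^* * a^*.
    by apply: (mulfI dc0); rewrite -h11; field.
  by elim/(ord3_ind ijk): x; elim/(ord3_ind ijk): y;
    rewrite ?(Xii, Xij, Xkk, Ea, Eb, Ed, Ep, Eq, Er) ?conjE ?mulr0 //
            ?mulrN -?pE // divfK.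
have bb0 : b * b^* != 0 by rewrite mul_conjC_eq0.
(* [h22] says |b|^2 + |q|^2 = |r|^2, with b nonzero. *)
have norm_rq : `|r| = `|q| -> False.
  move=> erq; move/eqP: bb0; apply; apply: (addIr (q * q^*)).
  by rewrite h22 add0r -normCKC erq normCK.
have d0 : d != 0.
  (* Otherwise X is supported on a 3-cycle, so that X^3 = abr. *)
  apply/eqP => d0; rewrite d0 in Ed.
  rewrite d0 ?(conjE, mul0r, mulr0, subr0, addr0, add0r) in h11 h12 h13 h23.
  have hpr : p * r^* = p^* * q.
    have : 2%:R * (p * r^* - p^* * q) = 0.
      have := subrr (p^* * q - r^* * p); rewrite -{1}h23 => <-; ring.
    by move/eqP; rewrite mulf_eq0 pnatr_eq0 /= subr_eq0 => /eqP.
  have p0 : p = 0.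
    apply/eqP/negPn/negP => p0; apply: norm_rq.
    move/(congr1 Num.norm): hpr; rewrite !normrM !norm_conjC.
    by apply: mulfI; rewrite normr_eq0.
  have q0 : q = 0.
    apply/eqP; move/eqP: h13; rewrite p0 conjE mulr0 oppr0 eq_sym mulf_eq0.
    by rewrite conjC_eq0 (negPf b0).
  apply: (sX (a * b * r)); apply/matrixP => x y; rewrite !mxE.
  rewrite (sum_ord3 ijk) !mxE !(sum_ord3 ijk).
  move: (ijk); rewrite /= !inE negb_or andbT => /andP[/andP[ij ik] jk].
  have ijE := (negPf ij, negPf ik, negPf jk, eqxx).
  by elim/(ord3_ind ijk): x; elim/(ord3_ind ijk): y;
    rewrite ?ijE ?[j == i]eq_sym ?[k == i]eq_sym ?[k == j]eq_sym ?ijE;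
    rewrite ?(Xii, Xij, Xkk, Ea, Eb, Ed, Ep, Eq, Er) ?(p0, q0) /=; ring.
have p0 : p != 0.
  apply: contraNneq b0 => p0; move/eqP: h23.
  rewrite p0 !(conjE, mul0r, mulr0, subr0, addr0) mulf_eq0 conjC_eq0.
  by rewrite (negPf d0) orbF.
have r0 : r != 0.
  apply: contraNneq bb0 => r0; move/eqP: h22.
  by rewrite r0 mulr0 paddr_eq0 ?mul_conjC_ge0 // => /andP[].
(* With q = 0, [h13] gives |a| = |d|, and then [h11] gives b = 0. *)
have q0 : q != 0.
  apply: contraNneq bb0 => q0; move: h13 h11.
  rewrite q0 mulr0 add0r => /oppr_inj /(congr1 Num.norm).
  rewrite !normrM !norm_conjC => /mulIf; rewrite normr_eq0 => /(_ p0) ead.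
  rewrite -[a * _]normCK -[d^* * d]normCKC ead [b^* * b]mulrC => /eqP.
  by rewrite -subr_eq subrr eq_sym.
by rewrite oppr_eq0.
Qed.

Lemma zero_antidiagonal_block X i j k : uniq [:: i; j; k] ->
  generic_normal X -> X i i = 0 -> X j k = 0 -> X k j = 0 -> False.
Proof.
move=> ijk gX Xii Xjk Xkj; have [nX tX _ cX _] := gX.
have jki : uniq [:: j; k; i] by rewrite -[[:: j; k; i]]/(rot 1 [:: i; j; k]) rot_uniq.
have Xkk := traceless_last_diag ijk tX Xii.
have p0 : X j j != 0.
  apply/eqP => p0; move: Xkk; rewrite p0 oppr0 => Xkk.
  by have [_ [/eqP]] := zero_pair_other_entries jki gX p0 Xjk.
have pc0 : (X j j)^* != 0 by rewrite conjC_eq0.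
have conjE := (rmorphN (@Num.conj C), rmorph0 (@Num.conj C)).
have := normalmx_entries i k nX; have := normalmx_entries i j nX.
rewrite !(sum_ord3 ijk) Xii Xjk Xkj Xkk !conjE.
rewrite !(mul0r, mulr0, add0r, addr0, mulrN, mulNr) => h12 /oppr_inj h13.
(* The ratio is read off from [h12] and [h13]. Since it has modulus 1, the relations for [X i j] and
   [X i k] also yield those for [X j i] and [X k i]. *)
pose c := X j j / (X j j)^*.
have Xij : X i j = c * (X j i)^*.
  by apply: (mulIf pc0); rewrite h12 /c; field.
have Xik : X i k = c * (X k i)^*.
  by apply: (mulIf pc0); rewrite h13 /c; field.
have cc : c * c^* = 1.
  by rewrite /c fmorph_div /= conjCK; field; rewrite p0.
apply: (cX c); apply/matrixP => x y; rewrite !mxE.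
elim/(ord3_ind ijk): x; elim/(ord3_ind ijk): y;
  rewrite ?(Xii, Xjk, Xkj, Xkk) ?conjE ?mulr0 ?mulrN ?[c * (X j j)^*]divfK //.
- by rewrite Xij rmorphM /= conjCK mulrA cc mul1r.
- by rewrite Xik rmorphM /= conjCK mulrA cc mul1r.
Qed.

Lemma card_row_zeros X (I : {set 'I_3 * 'I_3}) i j :
  generic_normal X -> (forall p, p \in I -> X p.1 p.2 = 0) ->
  i != j -> (i, i) \in I -> (i, j) \in I -> (#|I| <= 2)%N.
Proof.
move=> gX zX ij iiI ijI; have [k ijk] := ord3_third ij.
have [[n1 n2 n3] [n4 n5 n6 n7]] :=
  zero_pair_other_entries ijk gX (zX _ iiI) (zX _ ijI).
have/subset_leq_card/leq_trans : I \subset [set (i, i); (i, j)].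
  apply/subsetP => -[x y] /zX /= /eqP; rewrite !inE.
  by elim/(ord3_ind ijk): x; elim/(ord3_ind ijk): y; rewrite ?eqxx ?orbT //;
    rewrite ?(negPf n1, negPf n2, negPf n3, negPf n4, negPf n5, negPf n6, negPf n7).
by apply; rewrite cards2; case: eqP.
Qed.

Lemma card_col_zeros X (I : {set 'I_3 * 'I_3}) i j :
  generic_normal X -> (forall p, p \in I -> X p.1 p.2 = 0) ->
  i != j -> (i, i) \in I -> (j, i) \in I -> (#|I| <= 2)%N.
Proof.
move=> gX zX ij iiI jiI; pose swap (p : 'I_3 * 'I_3) := (p.2, p.1).
have swap_inj : injective swap by move=> [x y] [x' y'] [-> ->].
rewrite -(card_imset _ swap_inj).
apply: (card_row_zeros (generic_normal_tr gX) _ ij).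
- by move=> _ /imsetP[p pI ->]; rewrite mxE; apply: zX.
- by apply/imsetP; exists (i, i).
- by apply/imsetP; exists (j, i).
Qed.

(** The row and column bounds remove from [I] the rest of row and column [i], leaving (i,i), (k,k),
    (j,k), (k,j). If (k,k) were in [I], the same bounds at [k] would leave only two positions; so
    [I] is the pattern excluded by [zero_antidiagonal_block]. *)
Lemma generic_normal_zeros X (I : {set 'I_3 * 'I_3}) i j :
  generic_normal X -> (forall p, p \in I -> X p.1 p.2 = 0) ->
  (i, i) \in I -> (j, j) \notin I -> #|I| <> 3%N.
Proof.
move=> gX zX iiI jjI card3.
have row0 x y : x != y -> (x, x) \in I -> (x, y) \notin I.
  move=> xy xxI; apply/negP => xyI.
  by have := card_row_zeros gX zX xy xxI xyI; rewrite card3.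
have col0 x y : x != y -> (x, x) \in I -> (y, x) \notin I.
  move=> xy xxI; apply/negP => yxI.
  by have := card_col_zeros gX zX xy xxI yxI; rewrite card3.
have ij : i != j by apply: contraNneq jjI => <-.
have [k ijk] := ord3_third ij.
have /and3P[ik jk _] : [&& i != k, j != k & true].
  by move: ijk; rewrite /= !inE negb_or andbT => /andP[/andP[_ ->] ->].
have n1 := row0 _ _ ij iiI; have n2 := row0 _ _ ik iiI.
have n3 := col0 _ _ ij iiI; have n4 := col0 _ _ ik iiI.
have nE := (negPf n1, negPf n2, negPf n3, negPf n4, negPf jjI).
have kkI : (k, k) \notin I.
  apply/negP => kkI; rewrite eq_sym in jk.
  have n5 := row0 _ _ jk kkI; have n6 := col0 _ _ jk kkI.
  have /subset_leq_card : I \subset [set (i, i); (k, k)].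
    apply/subsetP => -[x y]; rewrite !inE.
    by elim/(ord3_ind ijk): x; elim/(ord3_ind ijk): y;
      rewrite ?eqxx ?orbT // ?(nE, negPf n5, negPf n6).
  by rewrite card3 cards2; case: eqP.
have IE : I = [set (i, i); (j, k); (k, j)].
  apply/eqP; rewrite eqEcard card3; apply/andP; split.
    apply/subsetP => -[x y]; rewrite !inE.
    by elim/(ord3_ind ijk): x; elim/(ord3_ind ijk): y;
      rewrite ?eqxx ?orbT // ?(nE, negPf kkI).
  by rewrite (leq_trans (leq_card_setU _ _)) // cards2 cards1; case: eqP.
apply: (zero_antidiagonal_block ijk gX); first exact: zX iiI.
- by apply: (zX (j, k)); rewrite IE !inE eqxx orbT.
- by apply: (zX (k, j)); rewrite IE !inE eqxx orbT.
Qed.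

(* The eigenvalues 1, i, -1-i have sum zero but are neither collinear nor the
   vertices of an equilateral triangle. *)
Definition witness : 'M[C]_3 :=
  diag_mx (\row_l tnth [tuple 1; 'i; -1 - 'i] l).

Lemma generic_normal_witness : generic_normal witness.
Proof.
pose o0 : 'I_3 := ord0; pose o1 : 'I_3 := lift ord0 ord0; pose o2 : 'I_3 := ord_max.
have o012 : uniq [:: o0; o1; o2] by [].
have i2 : 'i * 'i = -1 :> C by rewrite -expr2 sqrCi.
have n11 : (1 : C) != -1 by rewrite -subr_eq0 opprK -[1 + 1]/(2%:R) pnatr_eq0.
have ni1 (s : C) : s * s = 1 -> 'i != s.
  by move=> ss; apply: contraNneq n11 => si; rewrite -i2 si ss.
split.
- by apply/normalmxP; rewrite /witness tr_diag_mx map_diag_mx diag_mxC.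
- by rewrite /mxtrace (sum_ord3 o012) !mxE !eqxx !mulr1n !(tnth_nth 0) /=; ring.
- rewrite det_diag; apply/prodf_neq0 => l _; rewrite mxE (tnth_nth 0).
  elim/(ord3_ind o012): l; rewrite /= ?oner_eq0 ?neq0Ci //.
  by rewrite subr_eq0 eq_sym ni1 // mulrNN mulr1.
(* In this case and the next, entry (0, 0) gives c = 1; entry (1, 1) then reads i = -i here and i^3
   = 1 below. *)
- move=> c /matrixP e; move: (e o0 o0) (e o1 o1).
  rewrite !mxE !eqxx !mulr1n !(tnth_nth 0) /= conjC1 mulr1 conjCi => <- /eqP.
  rewrite mul1r -subr_eq0 opprK -mulr2n mulrn_eq0 /=.
  by rewrite (negPf (neq0Ci _)).
- move=> c; rewrite !mulmx_diag => /matrixP e.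
  move: (e o0 o0) (e o1 o1).
  rewrite !mxE !eqxx !mulr1n !(tnth_nth 0) /= !mulr1 => <-.
  rewrite i2 mulN1r => /eqP; rewrite eqr_oppLR; apply/negP/ni1.
  by rewrite mulrNN mulr1.
Qed.

End GenericNormal.

Theorem proposition2p6 (R : realType) (I : pattern 3) :
  proper_pattern I -> ~~ strict_pattern I -> #|I| = 3 ->
  ~ universal_pattern R I.
Proof.
move=> /existsP[j jjI]; rewrite /strict_pattern negb_forall.
move=> /existsP[i /negPn iiI] card3 univ.
have gA := generic_normal_witness (R[i]%C).
have [|X XI [P uP /eqP eX]] := univ (witness _).
  by have [_ tA _ _ _] := gA; apply/eqP.
have gX : generic_normal X.
  have <- : (P *m witness _ *m P^t*%sesqui)%R = X.
    (* Similarity is phrased with the pseudo-inverse, which for a unitary matrix is the adjoint. *)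
    by rewrite -pinvmx_unitary.
  exact: generic_normal_unitary.
apply: (generic_normal_zeros gX _ iiI jjI card3) => p pI.
by move: XI => /andP[_ /forall_inP/(_ p pI)/eqP].
Qed.
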